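(* Let $0\le\varepsilon<1$. Let $W,M$ be disjoint with $|W|=|M|=n$ and let $\mu$ be a fixed perfect marriage between $W$ and $M$ (known to both parties). Consider the promise problem in which Alice holds a full preference profile $\succ_W$ of the women, Bob holds a full preference profile $\succ_M$ of the men, it is promised that $\mu$ is either stable or $\varepsilon$-unstable with respect to $\succ_W,\succ_M$, and the parties must decide which of the two holds. The randomized two-party communication complexity of this problem is $\Omega(n^2)$.
   Context: A full preference profile of the women gives each woman a total order on $M$; that of the men gives each man a total order on $W$. A perfect marriage is a bijection between $W$ and $M$, identified with its set of $n$ married pairs. A pair $(w,m)$ is blocking for a perfect marriage $\mu$ if $w$ prefers $m$ to her spouse in $\mu$ and $m$ prefers $w$ to his spouse in $\mu$; $\mu$ is stable if it has no blocking pair. The divorce distance is $d(\mu,\mu')=n-|\mu\cap\mu'|$ and $d(\mu)=\min_{\mu'}d(\mu,\mu')$ over stable perfect marriages $\mu'$; $\mu$ is $\varepsilon$-unstable if $d(\mu)>\varepsilon n$. In two-party communication complexity, the cost of a protocol is the number of bits exchanged in the worst case over (promise-satisfying) inputs; a randomized protocol must answer correctly with probability at least $2/3$ on every input; the complexity is the least cost of such a protocol. The bound is asymptotic in $n$. *)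

(* Defs.v *)
From HB Require Import structures.
From mathcomp Require Import all_boot all_order all_algebra all_fingroup.
From mathcomp Require Import reals.
Set Implicit Arguments. Unset Strict Implicit. Unset Printing Implicit Defensive.
Import Order.TTheory GRing.Theory Num.Theory.

(** * Stable marriages.
    Women are ['I_n] and men are ['I_n] (two disjoint copies, distinguished by role).
    A perfect marriage is a permutation [mu] : woman [w] is married to man [mu w].
    A preference order of a woman on men is given by a ranking [r : {perm 'I_n}]:
    [r m] is the position of man [m] (0 = most preferred); [w] prefers [m] to [m']
    iff [r m < r m']. Such rankings are exactly the total orders on a set of size n. *)

Definition marriage (n : nat) := {perm 'I_n}.
Definition wprofile (n : nat) := {ffun 'I_n -> {perm 'I_n}}.
Definition mprofile (n : nat) := {ffun 'I_n -> {perm 'I_n}}.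

Definition wprefers n (PW : wprofile n) (w m m' : 'I_n) : bool := PW w m < PW w m'.
Definition mprefers n (PM : mprofile n) (m w w' : 'I_n) : bool := PM m w < PM m w'.

Definition blocking n (PW : wprofile n) (PM : mprofile n) (mu : marriage n)
  (w m : 'I_n) : bool :=
  wprefers PW w m (mu w) && mprefers PM m w ((mu^-1)%g m).

Definition stable n (PW : wprofile n) (PM : mprofile n) (mu : marriage n) : bool :=
  [forall w, forall m, ~~ blocking PW PM mu w m].

Definition divorce_dist n (mu mu' : marriage n) : nat :=
  n - #|[set w | mu w == mu' w]|.

(* d(mu) = min over stable mu' of d(mu,mu') (the default n is never smaller than
   any distance, and stable marriages always exist) *)
Definition dist_to_stable n (PW : wprofile n) (PM : mprofile n) (mu : marriage n) : nat :=
  \big[minn/n]_(mu' : marriage n | stable PW PM mu') divorce_dist mu mu'.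

Definition eps_unstable (R : realType) (eps : R) n (PW : wprofile n) (PM : mprofile n)
  (mu : marriage n) : bool :=
  (eps * n%:R < (dist_to_stable PW PM mu)%:R)%R.

Inductive protocol (A B : Type) : Type :=
| Leaf of bool
| AliceSends of (A -> bool) & protocol A B & protocol A B
| BobSends of (B -> bool) & protocol A B & protocol A B.
Arguments Leaf {A B}.

Fixpoint run A B (P : protocol A B) (a : A) (b : B) : bool :=
  match P with
  | Leaf o => o
  | AliceSends f P0 P1 => if f a then run P1 a b else run P0 a b
  | BobSends g P0 P1 => if g b then run P1 a b else run P0 a b
  end.

Fixpoint bits_on A B (P : protocol A B) (a : A) (b : B) : nat :=
  match P with
  | Leaf _ => 0
  | AliceSends f P0 P1 => (if f a then bits_on P1 a b else bits_on P0 a b).+1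
  | BobSends g P0 P1 => (if g b then bits_on P1 a b else bits_on P0 a b).+1
  end.

(** * Public-coin randomized protocols: a probability distribution [p] on a finite
    set [Omega] of random strings and, for each random string, a deterministic
    protocol. *)
Definition is_distribution (R : realType) (Omega : finType) (p : {ffun Omega -> R}) :=
  (forall r, 0 <= p r)%R /\ (\sum_(r : Omega) p r = 1)%R.

Definition rcost (R : realType) (A B Omega : finType) (promise : A -> B -> bool)
  (p : {ffun Omega -> R}) (T : Omega -> protocol A B) : nat :=
  \max_(r : Omega | p r != 0%R) \max_(ab : A * B | promise ab.1 ab.2) bits_on (T r) ab.1 ab.2.

Definition rcorrect (R : realType) (A B Omega : finType) (promise : A -> B -> bool)
  (answer : A -> B -> bool) (p : {ffun Omega -> R}) (T : Omega -> protocol A B) : Prop :=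
  forall a b, promise a b ->
    (2%:R / 3%:R <= \sum_(r : Omega | run (T r) a b == answer a b) p r)%R.

Definition stab_promise (R : realType) (eps : R) n (mu : marriage n)
  (PW : wprofile n) (PM : mprofile n) : bool :=
  stable PW PM mu || eps_unstable eps PW PM mu.

Definition stab_answer n (mu : marriage n) (PW : wprofile n) (PM : mprofile n) : bool :=
  stable PW PM mu.

(* Main.v *)
(** Stability testing contains set disjointness on k^2 = Theta(n^2) bits: a
    preferred pair of the first 2k couples blocks [mu] iff both parties hold the
    corresponding bit, and the other n - 2k couples form a chain that breaks up
    entirely in every stable marriage once one pair blocks.

    Disjointness is hard by a corruption argument in the style of Razborov. Split
    the coordinates by a uniform set D, let x be uniform on D and y uniform on its
    complement, and compare planting (0,0) and (1,1) at a random coordinate i. In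
    a rectangle S x T whose slices are not exponentially small, for all but few i
    forcing i into x costs at most a factor 5/6 compared with forcing it out of x,
    for otherwise S would be too biased to be large; likewise for y. Hence the mass
    of planted (0,0) in the rectangle is at most (6/5)^2 times that of planted
    (1,1), up to small errors. Since (6/5)^2 / 3 < 2/3, a protocol with error 1/3
    needs exponentially many rectangles. *)

Require Import Defs.
From HB Require Import structures.
From mathcomp Require Import all_boot all_order all_algebra all_fingroup.
From mathcomp Require Import reals sequences exp.
From mathcomp Require Import lra zify ring.
Set Implicit Arguments. Unset Strict Implicit. Unset Printing Implicit Defensive.
Import Order.TTheory GRing.Theory Num.Theory.

(** * Families of sets biased at many coordinates are exponentially small *)

Section BiasedFamilies.
Local Open Scope ring_scope.
Variables (R : realType) (I : finType).
Implicit Types (F : {set {set I}}) (B X : {set I}).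

(* The weights 12/11 and 10/11 average to 1, while their geometric mean with
   weights 6/11 and 5/11 exceeds 1. *)
Definition bias_rate : R := (6 * ln (12 / 11) + 5 * ln (10 / 11)) / 11.

Lemma bias_rate_gt0 : 0 < bias_rate.
Proof.
rewrite /bias_rate divr_gt0 //.
have -> : 6 * ln (12 / 11 : R) = ln ((12 / 11) ^+ 6) by rewrite lnXn ?mulr_natl //; lra.
have -> : 5 * ln (10 / 11 : R) = ln ((10 / 11) ^+ 5) by rewrite lnXn ?mulr_natl //; lra.
rewrite -lnM ?posrE ?exprn_gt0 //; try lra.
by rewrite ln_gt0 //; lra.
Qed.

Lemma sum_prod_weights B :
  \sum_(X : {set I}) \prod_(i in B) (if i \in X then 10 / 11 else 12 / 11 : R)
  = 2 ^+ #|I|.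
Proof.
pose f (b : bool) i : R := if i \in B then (if b then 10 / 11 else 12 / 11) else 1.
transitivity (\prod_i (f true i + f false i)).
  rewrite bigA_distr; apply: eq_bigr => X _.
  rewrite big_mkcond; apply: eq_bigr => i _.
  by rewrite /f; case: ifP; case: ifP.
rewrite (eq_bigr (fun=> 2)) ?prodr_const ?cardT // => i _.
by rewrite /f; case: ifP => _; lra.
Qed.

(** Jensen's inequality: bias leaves at most 5/11 of [F] containing each [i] in [B], so the mean
    over [F] of the logarithm of the weight product is at least [bias_rate * #|B|], while all
    products sum to [2 ^+ #|I|]. *)
Lemma card_biased_family F B :
  {in B, forall i, 6 * #|[set X in F | i \in X]| <= 5 * #|[set X in F | i \notin X]|}%N ->
  #|F|%:R <= 2 ^+ #|I| * expR (- (bias_rate * #|B|%:R)) :> R.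
Proof.
move=> biased; set L := bias_rate * #|B|%:R.
rewrite expRN -ler_pdivrMr ?invr_gt0 ?expR_gt0 // invrK.
pose v (b : bool) : R := if b then ln (10 / 11) else ln (12 / 11).
pose g X := \sum_(i in B) v (i \in X).
have expg X : expR (g X) = \prod_(i in B) (if i \in X then 10 / 11 else 12 / 11).
  rewrite /g expR_sum; apply: eq_bigr => i _.
  by rewrite /v; case: ifP => _; rewrite lnK // posrE; lra.
have sumg : L * #|F|%:R <= \sum_(X in F) g X.
  rewrite /L mulrAC mulr_natr -sumr_const exchange_big /= ler_sum // => i iB.
  rewrite (bigID (fun X => i \in X)) /=.
  rewrite (eq_bigr (fun=> v true)); last by move=> X /andP[_ ->].
  rewrite [X in _ <= _ + X](eq_bigr (fun=> v false)); last by move=> X /andP[_ /negPf->].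
  rewrite !sumr_const.
  have -> : #|[pred X in F | i \in X]| = #|[set X in F | i \in X]|.
    by apply: eq_card => X; rewrite !inE.
  have -> : #|[pred X in F | i \notin X]| = #|[set X in F | i \notin X]|.
    by apply: eq_card => X; rewrite !inE.
  have -> : #|F| = (#|[set X in F | i \in X]| + #|[set X in F | i \notin X]|)%N.
    rewrite -(cardsID [set X : {set I} | i \in X] F).
    by congr (_ + _)%N; apply: eq_card => X; rewrite !inE // andbC.
  have := biased i iB.
  move: #|_| #|_| => c0 c1; rewrite -(ler_nat R) !natrM => c10.
  rewrite /v -(mulr_natr _ c1) -(mulr_natr _ c0) natrD /bias_rate.
  have st : ln (10 / 11) <= ln (12 / 11) :> R by rewrite ler_ln ?posrE; lra.
  have : 0 <= (ln (12 / 11) - ln (10 / 11)) * (5 * c0%:R - 6 * c1%:R) :> R.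
    by apply: mulr_ge0; [rewrite subr_ge0 | lra].
  move: (ln _) (ln _) (c0%:R) (c1%:R) {st c10} => s t x y; lra.
(* The tangent to [expR] at [L] bounds each term from below; by [sumg] the sum of [g X - L] is
   nonnegative. *)
apply: (@le_trans _ _ (\sum_(X in F) expR (g X))).
  apply: (@le_trans _ _ (\sum_(X in F) expR L * (1 + (g X - L)))).
    rewrite -mulr_sumr mulrC ler_pM2l ?expR_gt0 //.
    rewrite big_split /= sumrB !sumr_const /= -[L *+ _]mulr_natr.
    by move: sumg; lra.
  apply: ler_sum => X _.
  have -> : expR (g X) = expR L * expR (g X - L) by rewrite -expRD addrC subrK.
  by rewrite ler_pM2l ?expR_gt0 // expR_ge1Dx.
rewrite -(sum_prod_weights B) [leRHS](bigID [in F]) /=.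
rewrite (eq_bigr _ (fun X _ => expg X)) lerDl.
by apply: sumr_ge0 => X _; apply: prodr_ge0 => i _; case: ifP => _; lra.
Qed.

End BiasedFamilies.

(** * Corruption inequality for rectangles *)

Section DisjointnessCorruption.
Local Open Scope ring_scope.
Variables (R : realType) (I : finType).
Implicit Types (S T : {set {set I}}) (D X Y : {set I}) (i : I).

(** Symmetric difference with [[set i]]: an involution pairing the sets that contain [i] with those
    that do not. *)
Definition toggle i X : {set I} := if i \in X then X :\ i else i |: X.

Lemma in_toggle i X : (i \in toggle i X) = (i \notin X).
Proof. by rewrite /toggle; case: ifP => iX; rewrite !inE eqxx. Qed.

Lemma toggleD1 i X : toggle i X :\ i = X :\ i.
Proof.
by rewrite /toggle; case: ifP => _; apply/setP => j; rewrite !inE; case: eqP.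
Qed.

Lemma toggleU1 i X : i |: toggle i X = i |: X.
Proof.
by rewrite /toggle; case: ifP => _; apply/setP => j; rewrite !inE; case: eqP.
Qed.

Lemma toggleK i : involutive (toggle i).
Proof.
move=> X; rewrite {1}/toggle in_toggle; case: ifPn => iX.
  by rewrite toggleD1; apply/setP => j; rewrite !inE; case: eqP => // ->; rewrite (negPf iX).
by rewrite toggleU1; apply/setP => j; rewrite !inE; case: eqP => // ->; rewrite (negPn iX).
Qed.

Lemma sum_toggle_half i (G : {set I} -> R) :
  (forall X, G (toggle i X) = G X) ->
  \sum_X G X = 2 * \sum_(X : {set I} | i \in X) G X.
Proof.
move=> Gt; rewrite (bigID (fun X : {set I} => i \in X)) /= mulr2n mulrDl mul1r; congr (_ + _).
rewrite (reindex_inj (inv_inj (toggleK i))) /=.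
by apply: eq_big => [X | X _]; rewrite ?Gt // in_toggle negbK.
Qed.

Lemma sum_toggle_halfN i (G : {set I} -> R) :
  (forall X, G (toggle i X) = G X) ->
  \sum_X G X = 2 * \sum_(X : {set I} | i \notin X) G X.
Proof.
move=> Gt; rewrite (sum_toggle_half Gt); congr (_ * _).
rewrite (reindex_inj (inv_inj (toggleK i))) /=.
by apply: eq_big => [X | X _]; rewrite ?Gt // in_toggle.
Qed.

(* [slice S D] counts the X whose trace on D lies in S; [slice0] and [slice1]
   first force i out of, respectively into, the trace. *)
Definition slice S D : R := \sum_(X : {set I}) (X :&: D \in S)%:R.
Definition slice0 S D i : R := \sum_(X : {set I}) ((X :&: D) :\ i \in S)%:R.
Definition slice1 S D i : R := \sum_(X : {set I}) (i |: (X :&: D) \in S)%:R.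

Definition skewed S D i : bool := 6 * slice1 S D i < 5 * slice0 S D i.

Lemma slice_ge0 S D : 0 <= slice S D.
Proof. by apply: sumr_ge0. Qed.

Lemma slice0_ge0 S D i : 0 <= slice0 S D i.
Proof. by apply: sumr_ge0. Qed.

Lemma slice1_ge0 S D i : 0 <= slice1 S D i.
Proof. by apply: sumr_ge0. Qed.

Lemma slice_card S D : slice S D = #|[set X | X :&: D \in S]|%:R.
Proof.
rewrite /slice -natr_sum -sum1dep_card [in RHS]big_mkcond /=.
by congr (_%:R); apply: eq_bigr => X _; case: ifP.
Qed.

Lemma card_setI : #|{set I}|%:R = 2 ^+ #|I| :> R.
Proof.
have -> : #|{set I}| = (2 ^ #|I|)%N.
  by rewrite -[LHS]cardsT -powersetT card_powerset cardsT.
by rewrite natrX.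
Qed.

Lemma sum_set_const (x : R) : \sum_(X : {set I}) x = 2 ^+ #|I| * x.
Proof. by rewrite sumr_const -card_setI mulr_natl. Qed.

Lemma slice_le S D : slice S D <= 2 ^+ #|I|.
Proof. by rewrite slice_card -card_setI ler_nat max_card. Qed.

Lemma slice0_toggle S D i : slice0 S (toggle i D) i = slice0 S D i.
Proof.
by apply: eq_bigr => X _; rewrite -!setIDA toggleD1.
Qed.

Lemma slice1_toggle S D i : slice1 S (toggle i D) i = slice1 S D i.
Proof. by apply: eq_bigr => X _; rewrite !setUIr toggleU1. Qed.

Lemma toggleC i D : toggle i (~: D) = ~: toggle i D.
Proof.
rewrite /toggle inE; case: (i \in D); apply/setP => j; rewrite !inE;
by case: (j == i); rewrite /= ?andbF ?orbT.
Qed.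

Lemma skewed_toggle S D i : skewed S (toggle i D) i = skewed S D i.
Proof. by rewrite /skewed slice0_toggle slice1_toggle. Qed.

Lemma slice0_notin S D i : i \notin D -> slice0 S D i = slice S D.
Proof.
move=> iD; apply: eq_bigr => X _.
suff -> : X :&: D :\ i = X :&: D by [].
by apply/setP => j; rewrite !inE; case: eqP => // ->; rewrite (negPf iD) andbF.
Qed.

(** The summand ignores whether [i] is in [X], so the [X] avoiding [i] carry half of the sum, and
    for these removing [i] changes nothing. *)
Lemma slice0_in S D i : i \in D ->
  slice0 S D i = 2 * #|[set X in [set X | X :&: D \in S] | i \notin X]|%:R.
Proof.
move=> iD; rewrite /slice0 (@sum_toggle_halfN i); last first.
  by move=> X; rewrite -!setIDAC toggleD1.
congr (_ * _); rewrite -natr_sum -sum1dep_card [in LHS]big_mkcond [in RHS]big_mkcond /=.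
congr (_%:R); apply: eq_bigr => X _; rewrite !inE.
case: ifP => iX; rewrite ?andbF ?andbT //.
have -> : X :&: D :\ i = X :&: D; last by case: (_ \in S).
by apply/setP => j; rewrite !inE; case: eqP => // ->; rewrite (negPf iX).
Qed.

Lemma slice1_in S D i : i \in D ->
  slice1 S D i = 2 * #|[set X in [set X | X :&: D \in S] | i \in X]|%:R.
Proof.
move=> iD; rewrite /slice1 (@sum_toggle_half i); last first.
  by move=> X; rewrite !setUIr toggleU1.
congr (_ * _); rewrite -natr_sum -sum1dep_card [in LHS]big_mkcond [in RHS]big_mkcond /=.
congr (_%:R); apply: eq_bigr => X _; rewrite !inE.
case: ifP => iX; rewrite ?andbF ?andbT //.
have -> : i |: (X :&: D) = X :&: D; last by case: (_ \in S).
by apply/setP => j; rewrite !inE; case: eqP => // ->; rewrite iX iD.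
Qed.

Lemma slice0_le S D i : i \in D -> slice0 S D i <= 2 * slice S D.
Proof.
move=> iD; rewrite slice0_in // slice_card ler_pM2l // ler_nat subset_leq_card //.
by apply/subsetP => X; rewrite !inE => /andP[].
Qed.

(* Density below which a slice may be skewed at more than #|I|/100 coordinates. *)
Definition tail : R := expR (- (bias_rate R * (#|I|%:R / 100))).

(** Either at most [#|I| / 100] coordinates of [D] are skewed, or the slice is biased at more than
    that many and [card_biased_family] bounds it by [2 ^+ #|I| * tail]. *)
Lemma slice_skewed_le S D :
  slice S D * #|[set i in D | skewed S D i]|%:R
  <= slice S D * (#|I|%:R / 100) + #|I|%:R * (2 ^+ #|I| * tail).
Proof.
set B := [set i in D | _].
have tail_ge0 : 0 <= #|I|%:R * (2 ^+ #|I| * tail).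
  by rewrite !mulr_ge0 ?exprn_ge0 ?expR_ge0.
have [small|large] := leP #|B|%:R (#|I|%:R / 100 : R).
  by rewrite -[leLHS]addr0 lerD // ler_wpM2l ?slice_ge0.
rewrite -[leLHS]add0r lerD //; first by rewrite mulr_ge0 ?slice_ge0 ?divr_ge0.
rewrite mulrC ler_pM ?slice_ge0 ?ler_nat ?max_card //.
rewrite slice_card; apply: (@le_trans _ _ (2 ^+ #|I| * expR (- (bias_rate R * #|B|%:R)))).
  apply: card_biased_family => i; rewrite inE => /andP[iD].
  rewrite /skewed slice0_in // slice1_in // => /ltW.
  by rewrite -(ler_nat R) !natrM; lra.
rewrite ler_pM2l ?exprn_gt0 // ler_expR lerN2 ler_pM2l ?bias_rate_gt0 //.
exact: ltW.
Qed.

(* A skewed i contributes the same for D and for D toggled at i, so one may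
   assume i in D, where forcing i out of the trace loses at most a factor 2. *)
Lemma skewed_mass_le S T :
  \sum_D \sum_(i | skewed S D i) slice0 S D i * slice0 T (~: D) i
  <= \sum_D 4 * (slice S D * slice T (~: D) * (#|I|%:R / 100)
                 + #|I|%:R * (4 ^+ #|I| * tail)).
Proof.
rewrite (exchange_big_dep xpredT) //=.
under eq_bigr => i _.
  rewrite big_mkcond (@sum_toggle_half i) /=; last first.
    by move=> D; rewrite skewed_toggle slice0_toggle -toggleC slice0_toggle.
  over.
rewrite -mulr_sumr (exchange_big_dep xpredT) //= mulr_sumr; apply: ler_sum => D _.
rewrite -big_mkcondr /=.
apply: (@le_trans _ _ (2 * \sum_(i in [set i in D | skewed S D i])
                             (2 * slice S D * slice T (~: D)))).
  rewrite ler_pM2l //.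
  rewrite (eq_bigl [in [set i in D | skewed S D i]]); last by move=> i; rewrite inE.
  apply: ler_sum => i; rewrite inE => /andP[iD _].
  rewrite (slice0_notin T) ?inE ?iD //.
  by rewrite ler_wpM2r ?slice_ge0 ?slice0_le.
rewrite sumr_const -mulr_natr.
have le1 := slice_skewed_le S D.
have le2 := slice_le T (~: D); have ge2 := slice_ge0 T (~: D).
have le3 := ler_wpM2r ge2 le1.
have : slice T (~: D) * (#|I|%:R * (2 ^+ #|I| * tail))
    <= 2 ^+ #|I| * (#|I|%:R * (2 ^+ #|I| * tail)).
  by rewrite ler_wpM2r // !mulr_ge0 ?exprn_ge0 ?expR_ge0.
have -> : 4 ^+ #|I| = 2 ^+ #|I| * 2 ^+ #|I| :> R by rewrite -exprMn -natrM.
by lra.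
Qed.

(** Where neither side is skewed, each [slice0] is at most 6/5 of [slice1], whence 36/25. The
    remaining terms go into two skewed masses, each contributing 4/100 and half of the error. *)
Lemma rectangle_slices S T :
  \sum_D \sum_i slice0 S D i * slice0 T (~: D) i
  <= \sum_D \sum_i (36 / 25 * (slice1 S D i * slice1 T (~: D) i)
                    + 8 / 100 * (slice S D * slice T (~: D)))
     + 8 * #|I|%:R * (8 ^+ #|I| * tail).
Proof.
have split_le D : \sum_i slice0 S D i * slice0 T (~: D) i <=
   \sum_i 36 / 25 * (slice1 S D i * slice1 T (~: D) i)
   + \sum_(i | skewed S D i) slice0 S D i * slice0 T (~: D) i
   + \sum_(i | skewed T (~: D) i) slice0 T (~: D) i * slice0 S D i.
  rewrite [X in _ + X + _]big_mkcond [X in _ + X]big_mkcond -!big_split /=.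
  apply: ler_sum => i _.
  have := slice0_ge0 S D i; have := slice0_ge0 T (~: D) i.
  have := slice1_ge0 S D i; have := slice1_ge0 T (~: D) i.
  rewrite /skewed.
  move: (slice0 _ _ _) (slice0 _ _ _) (slice1 _ _ _) (slice1 _ _ _) => a b c d.
  move=> d0 c0 b0 a0.
  have cd := mulr_ge0 c0 d0; have ab := mulr_ge0 a0 b0.
  case: ltP => h1; case: ltP => h2; try lra.
  by nra.
have tot : \sum_D \sum_i slice0 S D i * slice0 T (~: D) i <= _ := ler_sum _ (fun D _ => split_le D).
rewrite !big_split /= in tot.
have m1 := skewed_mass_le S T.
have m2 : \sum_D \sum_(i | skewed T (~: D) i) slice0 T (~: D) i * slice0 S D i
  <= \sum_D 4 * (slice S D * slice T (~: D) * (#|I|%:R / 100)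
                 + #|I|%:R * (4 ^+ #|I| * tail)).
  (* Complementing [D] exchanges the roles of [S] and [T]. *)
  rewrite (reindex_inj (@setC_inj I)) [leRHS](reindex_inj (@setC_inj I)) /=.
  under eq_bigr do rewrite setCK.
  under [leRHS]eq_bigr => D _ do rewrite setCK (mulrC (slice S _)).
  exact: skewed_mass_le.
have msum : \sum_D 4 * (slice S D * slice T (~: D) * (#|I|%:R / 100)
                 + #|I|%:R * (4 ^+ #|I| * tail)) =
     4 / 100 * (#|I|%:R * \sum_D slice S D * slice T (~: D))
      + 4 * #|I|%:R * (8 ^+ #|I| * tail).
  rewrite -mulr_sumr big_split /= -mulr_suml sum_set_const.
  have -> : 8 ^+ #|I| = 2 ^+ #|I| * 4 ^+ #|I| :> R by rewrite -exprMn -natrM.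
  by ring.
rewrite msum in m1 m2.
have -> : \sum_D \sum_i (36 / 25 * (slice1 S D i * slice1 T (~: D) i)
                       + 8 / 100 * (slice S D * slice T (~: D)))
  = \sum_D \sum_i 36 / 25 * (slice1 S D i * slice1 T (~: D) i)
    + 8 / 100 * (#|I|%:R * \sum_D slice S D * slice T (~: D)).
  rewrite mulrA mulr_sumr -big_split /=; apply: eq_bigr => D _.
  rewrite big_split /= sumr_const -(mulr_natr _ #|_|).
  by congr (_ + _); ring.
by lra.
Qed.
End DisjointnessCorruption.

(** * From rectangles to protocols *)

Section ProtocolRectangles.
Local Open Scope ring_scope.
Variables (R : realType) (A B : Type) (U V : finType) (a : U -> A) (b : V -> B).
Variables (Phi : (U -> V -> R) -> R) (K : R).
Hypothesis K_ge0 : 0 <= K.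
Hypothesis Phi_ext : forall G H, (forall x y, G x y = H x y) -> Phi G = Phi H.
Hypothesis PhiD : forall G H, Phi (fun x y => G x y + H x y) = Phi G + Phi H.
Hypothesis Phi_rectangle : forall (S : {set U}) (T : {set V}),
  - K <= Phi (fun x y => ((x \in S) && (y \in T))%:R).

(** The accepted inputs form a disjoint union of at most [2 ^ C] rectangles, one per accepting leaf
    reached. Each bit sent splits the current rectangle in two, and [Phi] is additive. *)
Lemma protocol_rectangles (P : protocol A B) (S : {set U}) (T : {set V}) (C : nat) :
  (forall x y, x \in S -> y \in T -> (bits_on P (a x) (b y) <= C)%N) ->
  - (2 ^+ C * K) <= Phi (fun x y => [&& x \in S, y \in T & run P (a x) (b y)]%:R).
Proof.
have Phi0 G : (forall x y, G x y = 0) -> Phi G = 0.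
  move=> G0; have : Phi G = Phi G + Phi G.
    by rewrite -PhiD; apply: Phi_ext => x y; rewrite !G0 addr0.
  by move/eqP; rewrite -subr_eq subrr eq_sym => /eqP.
have pow_ge0 D : 0 <= 2 ^+ D * K by rewrite mulr_ge0 ?exprn_ge0.
elim: P S T C => [o|f P0 IH0 P1 IH1|g P0 IH0 P1 IH1] S T C bits.
- case: o {bits} => /=.
    rewrite (@Phi_ext _ (fun x y => ((x \in S) && (y \in T))%:R)).
      apply: le_trans (Phi_rectangle S T); rewrite lerN2 ler_peMl //.
      by rewrite exprn_ege1 // ler1n.
    by move=> x y; rewrite andbT.
  by rewrite Phi0 ?oppr_le0 // => x y; rewrite !andbF.
(* On an empty rectangle [bits] is vacuous and [C] may be 0; otherwise the bit sent here forces [C]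
   to be positive. *)
- have [S0|[x0 x0S]] := set_0Vmem S.
    by rewrite Phi0 ?oppr_le0 // => x y; rewrite S0 inE.
  have [T0|[y0 y0T]] := set_0Vmem T.
    by rewrite Phi0 ?oppr_le0 // => x y; rewrite T0 inE andbF.
  case: C bits => [|C] bits; first by have := bits _ _ x0S y0T.
  rewrite (@Phi_ext _ (fun x y =>
      [&& x \in [set x in S | ~~ f (a x)], y \in T & run P0 (a x) (b y)]%:R
      + [&& x \in [set x in S | f (a x)], y \in T & run P1 (a x) (b y)]%:R)).
    rewrite PhiD exprS -mulrA mulr_natl mulr2n opprD lerD //.
      apply: IH0 => x y; rewrite inE => /andP[xS /negPf fx] yT.
      by have := bits x y xS yT; rewrite /= fx.
    apply: IH1 => x y; rewrite inE => /andP[xS fx] yT.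
    by have := bits x y xS yT; rewrite /= fx.
  move=> x y; rewrite !inE /=.
  by case: (x \in S); case: (f (a x)); case: (y \in T); rewrite /= ?addr0 ?add0r.
- have [S0|[x0 x0S]] := set_0Vmem S.
    by rewrite Phi0 ?oppr_le0 // => x y; rewrite S0 inE.
  have [T0|[y0 y0T]] := set_0Vmem T.
    by rewrite Phi0 ?oppr_le0 // => x y; rewrite T0 inE andbF.
  case: C bits => [|C] bits; first by have := bits _ _ x0S y0T.
  rewrite (@Phi_ext _ (fun x y =>
      [&& x \in S, y \in [set y in T | ~~ g (b y)] & run P0 (a x) (b y)]%:R
      + [&& x \in S, y \in [set y in T | g (b y)] & run P1 (a x) (b y)]%:R)).
    rewrite PhiD exprS -mulrA mulr_natl mulr2n opprD lerD //.
      apply: IH0 => x y xS; rewrite inE => /andP[yT /negPf gy].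
      by have := bits x y xS yT; rewrite /= gy.
    apply: IH1 => x y xS; rewrite inE => /andP[yT gy].
    by have := bits x y xS yT; rewrite /= gy.
  move=> x y; rewrite !inE /=.
  by case: (x \in S); case: (g (b y)); case: (y \in T); rewrite /= ?addr0 ?add0r.
Qed.

End ProtocolRectangles.

(** * Randomized lower bound for disjointness *)

Section Disjointness.
Local Open Scope ring_scope.
Variables (R : realType) (I : finType).
Implicit Types (D X Y : {set I}) (G H : {set I} -> {set I} -> R).

(* With D, X, Y and i uniform, the pair of traces of X on D and of Y on the
   complement of D is disjoint; the functional compares its versions in which
   (1,1), nothing, or (0,0) is planted at i. *)
Definition corruption G : R :=
  \sum_D \sum_i \sum_X \sum_Y
    (36 / 25 * G (i |: (X :&: D)) (i |: (Y :&: ~: D))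
     + 8 / 100 * G (X :&: D) (Y :&: ~: D)
     - G (X :&: D :\ i) (Y :&: ~: D :\ i)).

Lemma corruption_ext G H : (forall x y, G x y = H x y) -> corruption G = corruption H.
Proof.
move=> GH; apply: eq_bigr => D _; apply: eq_bigr => i _.
by apply: eq_bigr => X _; apply: eq_bigr => Y _; rewrite !GH.
Qed.

Lemma corruptionD G H :
  corruption (fun x y => G x y + H x y) = corruption G + corruption H.
Proof.
rewrite /corruption -big_split; apply: eq_bigr => D _.
rewrite -big_split; apply: eq_bigr => i _.
rewrite -big_split; apply: eq_bigr => X _.
by rewrite -big_split; apply: eq_bigr => Y _ /=; ring.
Qed.

Lemma corruption_sum (Omega : finType) (p : Omega -> R)
    (G : Omega -> {set I} -> {set I} -> R) :
  corruption (fun x y => \sum_r p r * G r x y) = \sum_r p r * corruption (G r).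
Proof.
rewrite /corruption; under [RHS]eq_bigr do rewrite mulr_sumr.
rewrite [RHS]exchange_big; apply: eq_bigr => D _.
under [RHS]eq_bigr do rewrite mulr_sumr.
rewrite [RHS]exchange_big; apply: eq_bigr => i _.
under [RHS]eq_bigr do rewrite mulr_sumr.
rewrite [RHS]exchange_big; apply: eq_bigr => X _.
under [RHS]eq_bigr do rewrite mulr_sumr.
rewrite [RHS]exchange_big; apply: eq_bigr => Y _.
rewrite !mulr_sumr -big_split -sumrB; apply: eq_bigr => r _ /=; ring.
Qed.

Lemma corruption_rectangle (S T : {set {set I}}) :
  - (8 * #|I|%:R * (8 ^+ #|I| * tail R I))
  <= corruption (fun x y => ((x \in S) && (y \in T))%:R).
Proof.
have indicator (f g : {set I} -> {set I}) :
  (\sum_X (f X \in S)%:R) * (\sum_Y (g Y \in T)%:R)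
  = \sum_X \sum_Y ((f X \in S) && (g Y \in T))%:R :> R.
  rewrite mulr_suml; apply: eq_bigr => X _.
  by rewrite mulr_sumr; apply: eq_bigr => Y _; rewrite -natrM mulnb.
have -> : corruption (fun x y => ((x \in S) && (y \in T))%:R) =
   \sum_D \sum_i (36 / 25 * (slice1 R S D i * slice1 R T (~: D) i)
                    + 8 / 100 * (slice R S D * slice R T (~: D)))
   - \sum_D \sum_i slice0 R S D i * slice0 R T (~: D) i.
  rewrite -sumrB; apply: eq_bigr => D _; rewrite -sumrB; apply: eq_bigr => i _.
  rewrite /slice0 /slice1 /slice !indicator !mulr_sumr -big_split -sumrB.
  apply: eq_bigr => X _ /=; rewrite !mulr_sumr -big_split -sumrB.
  by apply: eq_bigr.
by have := rectangle_slices R S T; lra.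
Qed.

Lemma disjointness_cost (A B Omega : finType) (p : {ffun Omega -> R})
    (T : Omega -> protocol A B) (a : {set I} -> A) (b : {set I} -> B) (C : nat) :
  is_distribution p ->
  (forall r, p r != 0 -> forall x y, (bits_on (T r) (a x) (b y) <= C)%N) ->
  (forall x y : {set I}, [disjoint x & y] -> 2 / 3 <= \sum_(r | run (T r) (a x) (b y)) p r) ->
  (forall x y : {set I}, ~~ [disjoint x & y] -> \sum_(r | run (T r) (a x) (b y)) p r <= 1 / 3) ->
  bias_rate R * (#|I|%:R / 100) <= C%:R + 75.
Proof.
move=> [p_ge0 p1] bits acc rej.
have [I0|I_gt0] := posnP #|I|; first by rewrite I0 mul0r mulr0 addr_ge0.
pose g x y := \sum_r p r * (run (T r) (a x) (b y))%:R.
have gE x y : g x y = \sum_(r | run (T r) (a x) (b y)) p r.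
  rewrite [RHS]big_mkcond; apply: eq_bigr => r _.
  by case: ifP; rewrite ?mulr1 ?mulr0.
have g_le1 x y : g x y <= 1.
  rewrite -p1; apply: ler_sum => r _.
  by case: (run _ _ _); rewrite ?mulr1 ?mulr0.
set K := 8 * #|I|%:R * (8 ^+ #|I| * tail R I).
have K_ge0 : 0 <= K by rewrite !mulr_ge0 ?exprn_ge0 ?expR_ge0.
have lower : - (2 ^+ C * K) <= corruption g.
  have -> : - (2 ^+ C * K) = \sum_r p r * - (2 ^+ C * K) by rewrite -mulr_suml p1 mul1r.
  rewrite corruption_sum; apply: ler_sum => r _.
  have [->|pr] := eqVneq (p r) 0; first by rewrite !mul0r.
  rewrite ler_wpM2l //.
  have le_r := @protocol_rectangles R A B _ _ a b corruption K K_ge0 corruption_ext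
    corruptionD corruption_rectangle (T r) setT setT C (fun x y _ _ => bits r pr x y).
  apply: (le_trans le_r); rewrite le_eqVlt; apply/orP; left; apply/eqP.
  by apply: corruption_ext => x y; rewrite !inE.
(* Termwise, 36/25 * 1/3 + 8/100 - 2/3 = -8/75: the (1,1) plant is rejected, the (0,0) plant
   accepted, and the unplanted term is at most 1. *)
have upper : corruption g <= - (8 / 75 * (#|I|%:R * 8 ^+ #|I|)).
  have -> : - (8 / 75 * (#|I|%:R * 8 ^+ #|I|)) =
      \sum_(D : {set I}) \sum_(i : I) \sum_(X : {set I}) \sum_(Y : {set I}) (- (8 / 75)) :> R.
    rewrite !sum_set_const sumr_const -(mulr_natr _ #|_|).
    have -> : 8 ^+ #|I| = 2 ^+ #|I| * (2 ^+ #|I| * 2 ^+ #|I|) :> R.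
      by rewrite -!exprMn -!natrM.
    by ring.
  apply: ler_sum => D _; apply: ler_sum => i _.
  apply: ler_sum => X _; apply: ler_sum => Y _.
  have g1 : g (i |: (X :&: D)) (i |: (Y :&: ~: D)) <= 1 / 3.
    rewrite gE; apply: rej; apply/pred0Pn; exists i.
    by rewrite /= !inE eqxx.
  have g0 : 2 / 3 <= g (X :&: D :\ i) (Y :&: ~: D :\ i).
    rewrite gE; apply: acc; apply/pred0P => j; rewrite /= !inE.
    by case: (j \in D); rewrite /= ?andbF.
  have := g_le1 (X :&: D) (Y :&: ~: D).
  by lra.
have : 1 <= 75 * (2 ^+ C * tail R I).
  have := le_trans lower upper; rewrite lerN2 /K => le1.
  have NI : 0 < #|I|%:R * 8 ^+ #|I| :> R by rewrite mulr_gt0 ?ltr0n ?exprn_gt0.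
  rewrite -(ler_pM2r NI); move: le1 {lower upper}; lra.
(* Taking logarithms crudely, with 75 at most [expR 75] and 2 at most [expR 1], produces the
   additive 75. *)
rewrite /tail expRN mulrA ler_pdivlMr ?expR_gt0 // mul1r => le1.
rewrite -ler_expR (le_trans le1) // addrC expRD.
apply: ler_pM; rewrite ?exprn_ge0 //.
  by apply: le_trans (expR_ge1Dx _); lra.
rewrite -[C%:R]mul1r expRM_natr.
by apply: lerXn2r; rewrite ?nnegrE ?expR_ge0 //; apply: le_trans (expR_ge1Dx _); lra.
Qed.

End Disjointness.

(** * Rankings induced by numerical keys *)

Section Ranking.
Variables (n : nat) (f : 'I_n -> nat).

(** Keys may collide; adding the index, which is below [n], separates them and keeps strict
    inequalities. *)
Definition tie_broken (x : 'I_n) : nat := f x * n + x.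

Lemma tie_broken_inj : injective tie_broken.
Proof.
move=> x y /(congr1 (modn^~ n)); rewrite /tie_broken !modnMDl !modn_small //.
exact: val_inj.
Qed.

Lemma tie_broken_lt x y : f x < f y -> tie_broken x < tie_broken y.
Proof.
move=> fxy; rewrite /tie_broken (@leq_trans ((f x).+1 * n)) //.
  by rewrite mulSn addnC ltn_add2r.
by rewrite (leq_trans _ (leq_addr _ _)) // leq_mul2r fxy orbT.
Qed.

Lemma rank_subproof (x : 'I_n) : #|[set y | tie_broken y < tie_broken x]| < n.
Proof.
rewrite -[X in _ < X]card_ord -cardsT proper_card // properE subsetT /=.
by apply/subsetPn; exists x; rewrite ?inE // ltnn.
Qed.

Definition rank (x : 'I_n) : 'I_n := Ordinal (rank_subproof x).

Lemma rank_lt x y : tie_broken x < tie_broken y -> rank x < rank y.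
Proof.
move=> xy; rewrite /= proper_card // properE; apply/andP; split.
  by apply/subsetP => z; rewrite !inE => /ltn_trans; apply.
by apply/subsetPn; exists x; rewrite !inE ?ltnn.
Qed.

Lemma rank_inj : injective rank.
Proof.
move=> x y rxy; apply: tie_broken_inj.
by case: (ltngtP (tie_broken x) (tie_broken y)) => // /rank_lt; rewrite rxy ltnn.
Qed.

Definition ranking : {perm 'I_n} := perm rank_inj.

Lemma ranking_lt x y : f x < f y -> ranking x < ranking y.
Proof. by move=> fxy; rewrite !permE; apply: rank_lt; apply: tie_broken_lt. Qed.

Lemma ranking_ltW x y : ranking x < ranking y -> f x <= f y.
Proof.
by move=> rxy; rewrite leqNgt; apply/negP => /ranking_lt; rewrite ltnNge ltnW.
Qed.

End Ranking.

(** With [mu' = mu] it gives distance 0 for a stable [mu], which is therefore never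
    [eps]-unstable. *)
Lemma dist_to_stable_le n (PW : wprofile n) (PM : mprofile n) (mu mu' : marriage n) :
  stable PW PM mu' -> dist_to_stable PW PM mu <= divorce_dist mu mu'.
Proof.
move=> st; rewrite /dist_to_stable; have := mem_index_enum mu'.
elim: (index_enum _) => // x r IH; rewrite inE big_cons => /predU1P[<-|/IH le_r].
  by rewrite st geq_minl.
by case: ifP => _ //; rewrite geq_min le_r orbT.
Qed.

(** * Reduction of disjointness to stability *)

Section Reduction.
Variables (n k : nat) (mu : marriage n).
Implicit Types (X Y : {set 'I_k * 'I_k}) (i j : nat).

(* Woman i and man [mu j] are addressed by the indices i and j. Couples below k
   supply the women, and couples from k to 2k the men, of the disjointness
   instance; the couples from 2k on form a chain: as soon as one man below k
   loses his wife, he takes woman 2k, whose husband takes woman 2k+1, etc. *)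
Definition edge X i j : bool := [exists q in X, (q.1 == i :> nat) && (k + q.2 == j)].

(** Key 1 marks the husband, so key 0 marks exactly the men for whom a woman would leave him. *)
Definition wkey X i j : nat :=
  if [|| edge X i j, (i == k.*2) && (j < k) | (k.*2 < i) && (i == j.+1)] then 0
  else if i == j then 1 else 2.

Definition mkey Y j i : nat :=
  if edge Y i j then 0 else if i == j then 1
  else if (i == if j < k then k.*2 else j.+1) then 2 else 3.

Definition wprof X : wprofile n :=
  [ffun w : 'I_n => ranking (fun m => wkey X w ((mu^-1)%g m))].
Definition mprof Y : mprofile n :=
  [ffun m : 'I_n => ranking (fun w : 'I_n => mkey Y ((mu^-1)%g m) w)].

Lemma edge_bounds X i j : edge X i j -> [/\ i < k, k <= j & j < k.*2].
Proof.
move=> /existsP[q /and3P[_ /eqP <- /eqP <-]].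
by rewrite ltn_ord leq_addr -addnn ltn_add2l ltn_ord.
Qed.

Lemma edge_mem X (q : 'I_k * 'I_k) : q \in X -> edge X q.1 (k + q.2).
Proof. by move=> qX; apply/existsP; exists q; rewrite qX !eqxx. Qed.

Lemma edge_common X Y i j : edge X i j -> edge Y i j -> ~~ [disjoint X & Y].
Proof.
move=> /existsP[[x1 x2] /and3P[qX /eqP /= xi /eqP xj]].
move=> /existsP[[y1 y2] /and3P[qY /eqP /= yi /eqP yj]].
apply/pred0Pn; exists (x1, x2); rewrite /= qX.
suff -> : (x1, x2) = (y1, y2) by [].
by congr (_, _); apply: val_inj; rewrite /=; lia.
Qed.

Lemma edgexx X i : edge X i i = false.
Proof. by case eii: (edge X i i) => //; have [] := edge_bounds eii; lia. Qed.

Lemma wkeyxx X i : wkey X i i = 1.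
Proof. by rewrite /wkey edgexx eqxx; case: ifP => //; lia. Qed.

Lemma mkeyxx Y j : mkey Y j j = 1.
Proof. by rewrite /mkey edgexx eqxx. Qed.

Lemma mkey_successor Y i j : (j < k) || (k.*2 <= j) ->
  i = (if j < k then k.*2 else j.+1) -> mkey Y j i = 2.
Proof.
move=> jk ->; rewrite /mkey eqxx; case: ifP => [/edge_bounds[]|_]; first by case: ifP; lia.
by case: ifP => //; case: ifP; lia.
Qed.

Lemma mkey_worst Y i j : (j < k) || (k.*2 <= j) ->
  i != j -> i != (if j < k then k.*2 else j.+1) -> mkey Y j i = 3.
Proof.
move=> jk /negPf ij /negPf inext; rewrite /mkey ij inext.
by case: ifP => // /edge_bounds[]; lia.
Qed.

(** A man prefers only his [Y]-edges to his wife. The index bounds of an edge exclude the chain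
    clauses of [wkey], so a blocking pair would be an edge of both sets. *)
Lemma stable_disjoint X Y : [disjoint X & Y] -> stable (wprof X) (mprof Y) mu.
Proof.
move=> XY; apply/forallP => w; apply/forallP => m; apply/negP => /andP[].
rewrite /wprefers /mprefers !ffunE => wm mw.
have := ranking_ltW wm; have := ranking_ltW mw; rewrite permK.
have : (mu^-1)%g m != w by apply/eqP => mwE; rewrite -mwE permKV ltnn in wm.
rewrite mkeyxx wkeyxx; move: ((mu^-1)%g m) => j jw.
have {}jw : (w == j :> nat) = false by apply/negP => /eqP/val_inj E; rewrite E eqxx in jw.
rewrite /mkey /wkey jw; case: ifP => eY; last by case: ifP.
have [wk kj j2k] := edge_bounds eY.
case: ifP => // /or3P[eX|/andP[/eqP]|/andP[]]; try lia.
by have := edge_common eX eY; rewrite XY.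
Qed.

Section Intersecting.
Variables (X Y : {set 'I_k * 'I_k}) (mu' : marriage n).
Hypothesis n2k : k.*2 < n.
Hypothesis XY : ~~ [disjoint X & Y].
Hypothesis mu'_stable : stable (wprof X) (mprof Y) mu'.

(** In [mu'], woman [i] marries the man of index [s i]; fixed points are the surviving couples. *)
Let s : {perm 'I_n} := (mu' * mu^-1)%g.

Lemma no_block (i j : 'I_n) :
  wkey X i j < wkey X i (s i) -> mkey Y j i < mkey Y j ((s^-1)%g j) -> False.
Proof.
move=> wij mji; have /forallP/(_ i)/forallP/(_ (mu j))/negP := mu'_stable.
apply; rewrite /blocking /wprefers /mprefers !ffunE.
apply/andP; split; apply: ranking_lt; rewrite ?permK //.
  by move: wij; rewrite /s permM.
by move: mji; rewrite /s invMg invgK permM.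
Qed.

(** Otherwise a common element of [X] and [Y] gives a blocking pair: its man cannot be married to
    any woman below [k], so his partner has a positive key. *)
Lemma some_woman_leaves : exists2 i : 'I_n, i < k & s i != i.
Proof.
have [/existsP[i /andP[ik si]]|] := boolP [exists i : 'I_n, (i < k) && (s i != i)].
  by exists i.
rewrite negb_exists => /forallP stay.
have {}stay (i : 'I_n) : i < k -> s i = i.
  by move=> ik; have := stay i; rewrite ik /= negbK => /eqP.
have /pred0Pn[q /andP[/= /edge_mem eX /edge_mem eY]] := XY.
have [q1k _ q2k] := edge_bounds eX.
have q1n : q.1 < n by rewrite (ltn_trans q1k) // (leq_ltn_trans _ n2k) // -addnn leq_addr.
have q2n := ltn_trans q2k n2k.
exfalso; apply: (@no_block (Ordinal q1n) (Ordinal q2n)).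
  by rewrite stay // wkeyxx /wkey /= eX.
rewrite {1}/mkey /= eY /mkey; case: ifP => [eY'|_]; last by case: ifP => // _; case: ifP.
have [i'k ? ?] := edge_bounds eY'.
have := stay _ i'k; rewrite permKV => E.
by move: i'k; rewrite -E /=; lia.
Qed.

(** If woman [i] stayed, she would block with man [j]: she prefers him to her husband, and he,
    having neither his wife nor her, has a partner of key 3. *)
Lemma next_woman_leaves (i j : 'I_n) : (j < k) || (k.*2 <= j) ->
  i = (if j < k then k.*2 else j.+1) :> nat -> s j != j -> s i != i.
Proof.
move=> jk inext sj; apply/eqP => si.
have iNj : i != j by apply: contraNneq sj => <-; rewrite si.
apply: (@no_block i j).
  rewrite si wkeyxx /wkey ifT //; apply/or3P; move: inext.
  case: ifP => jk' ->; first by constructor 2; rewrite eqxx.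
  by constructor 3; rewrite eqxx andbT; lia.
rewrite mkey_successor // mkey_worst // -?inext; apply: contraNneq sj.
  by move=> /val_inj {1}<-; rewrite permKV.
by move=> /val_inj E; move: iNj; rewrite -si -E permKV eqxx.
Qed.

Lemma chain_broken (j : 'I_n) : k.*2 <= j -> s j != j.
Proof.
case: j => j jn /= /subnKC; move: (j - k.*2) => d dj.
elim: d j jn dj => [|d IH] j jn dj.
  have [i ik si] := some_woman_leaves.
  by apply: (next_woman_leaves (j := i)); rewrite ?ik //= -dj addn0.
have jn' : k.*2 + d < n by lia.
apply: (next_woman_leaves (j := Ordinal jn')); last exact: IH.
  by rewrite /= leq_addr orbT.
by rewrite /= -dj addnS; case: ifP => //; lia.
Qed.

Lemma divorce_dist_intersecting : n - k.*2 <= divorce_dist mu mu'.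
Proof.
rewrite leq_sub2l // (@leq_trans #|[set w : 'I_n | w < k.*2]|) //.
  apply/subset_leq_card/subsetP => w; rewrite !inE => /eqP muw.
  rewrite ltnNge; apply: contraTN isT => /chain_broken.
  by rewrite permM -muw permK eqxx.
by rewrite -sum1dep_card -(big_ord_widen _ (fun=> 1) (ltnW n2k)) sum1_card card_ord.
Qed.

End Intersecting.

Lemma dist_to_stable_intersecting X Y : k.*2 < n -> ~~ [disjoint X & Y] ->
  n - k.*2 <= dist_to_stable (wprof X) (mprof Y) mu.
Proof.
move=> n2k XY; rewrite /dist_to_stable.
(* The default value [n] of the minimum satisfies the bound too. *)
elim/big_ind: _ => [|x y xn yn|mu' mu'_stable]; first exact: leq_subr.
  by rewrite leq_min xn yn.
exact: divorce_dist_intersecting mu'_stable.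
Qed.

End Reduction.

(** * Choice of parameters and the quadratic bound *)

Theorem theorem9 (R : realType) (eps : R) :
  (0 <= eps)%R -> (eps < 1)%R ->
  exists c : R, (0 < c)%R /\
  exists N : nat, forall n : nat, (N <= n)%N ->
  forall (mu : marriage n) (Omega : finType) (p : {ffun Omega -> R})
         (T : Omega -> protocol (wprofile n) (mprofile n)),
    is_distribution p ->
    rcorrect (stab_promise eps mu) (@stab_answer n mu) p T ->
    (c * (n ^ 2)%:R <= (rcost (stab_promise eps mu) p T)%:R)%R.
Proof.
move=> eps_ge0 eps_lt1.
have rate_gt0 := bias_rate_gt0 R; set rate := bias_rate R in rate_gt0.
(* With [k = n %/ q], this makes [2k] smaller than [(1 - eps) * n], so breaking [n - 2k] couples
   suffices. *)
pose q := (Num.truncn (2 / (1 - eps))).+1.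
have q_big : (2 < q%:R * (1 - eps))%R.
  by rewrite -ltr_pdivrMr ?subr_gt0 // truncnS_gt.
have q_gt0 : (0 < q%:R :> R)%R by rewrite ltr0n.
(* Since [n <= 2 * q * k], the disjointness bound [rate * k ^ 2 / 100] is at least [2 * c * n ^ 2];
   one half absorbs the 75. *)
pose c := (rate / (800 * q%:R ^+ 2))%R.
have c_gt0 : (0 < c)%R by rewrite divr_gt0 // mulr_gt0 // exprn_gt0.
(* The first bound ensures [k >= 1], the second [75 <= c * n]. *)
exists c; split=> //; exists (maxn q (Num.truncn (75 / c)).+1) => n.
rewrite geq_max => /andP[qn cn] mu Omega p T pdist correct.
set C := rcost _ _ _.
pose k := n %/ q.
have k_gt0 : 0 < k by rewrite divn_gt0.
have kq_le : k * q <= n by apply: leq_trunc_div.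
have n_lt : n < k.+1 * q by apply: ltn_ceil.
have few : (eps * n%:R < n%:R - k.*2%:R)%R.
  have n_gt0 : (0 < n%:R :> R)%R by rewrite ltr0n (leq_trans _ qn).
  have kqR : (k%:R * q%:R <= n%:R :> R)%R by rewrite -natrM ler_nat.
  rewrite -mul2n natrM -(ltr_pM2r q_gt0).
  have : (n%:R * 2 < n%:R * (q%:R * (1 - eps)))%R by rewrite ltr_pM2l.
  by move: kqR; clear; lra.
have n2k : k.*2 < n.
  rewrite -(ltr_nat R) -subr_gt0; apply: le_lt_trans few.
  by rewrite mulr_ge0.
pose a := @wprof n k mu; pose b := @mprof n k mu.
have unstable (x y : {set 'I_k * 'I_k}) : ~~ [disjoint x & y] -> eps_unstable eps (a x) (b y) mu.
  move=> xy; apply: lt_le_trans few _; rewrite -natrB ?(ltnW n2k) // ler_nat.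
  exact: dist_to_stable_intersecting.
have promise (x y : {set 'I_k * 'I_k}) : stab_promise eps mu (a x) (b y).
  rewrite /stab_promise; have [xy|xy] := boolP [disjoint x & y].
    by rewrite stable_disjoint.
  by rewrite unstable ?orbT.
have answer (x y : {set 'I_k * 'I_k}) : stab_answer mu (a x) (b y) = [disjoint x & y].
  have [xy|xy] := boolP [disjoint x & y]; first exact: stable_disjoint.
  apply/negbTE/negP => st; have := unstable _ _ xy; rewrite /eps_unstable.
  suff -> : dist_to_stable (a x) (b y) mu = 0 by rewrite ltNge mulr_ge0.
  apply/eqP; rewrite -leqn0; apply: leq_trans (dist_to_stable_le mu st) _.
  rewrite /divorce_dist; have -> : [set w | mu w == mu w] = setT.
    by apply/setP => w; rewrite !inE eqxx.
  by rewrite cardsT card_ord subnn.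
have cost : (rate * (#|{: 'I_k * 'I_k}|%:R / 100) <= C%:R + 75)%R.
  apply: (@disjointness_cost R _ _ _ _ p T a b C pdist) => [r pr x y|x y xy|x y xy].
  - apply: (@leq_trans (\max_(ab | stab_promise eps mu ab.1 ab.2)
                          bits_on (T r) ab.1 ab.2)).
      exact: (@leq_bigmax_cond _ (fun ab => stab_promise eps mu ab.1 ab.2)
                (fun ab => bits_on (T r) ab.1 ab.2) (a x, b y) (promise x y)).
    exact: (@leq_bigmax_cond _ (fun r => p r != 0%R) (fun r => \max_(ab |
              stab_promise eps mu ab.1 ab.2) bits_on (T r) ab.1 ab.2) r pr).
  - have := correct _ _ (promise x y); rewrite answer xy.
    by under eq_bigl do rewrite eqb_id.
  - have := correct _ _ (promise x y); rewrite answer (negPf xy).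
    under eq_bigl do rewrite eqbF_neg.
    have [_] := pdist; rewrite (bigID (fun r => run (T r) (a x) (b y))) /=.
    by lra.
rewrite card_prod card_ord natrM in cost.
have nk : (n%:R <= 2 * q%:R * k%:R :> R)%R.
  by rewrite -!natrM ler_nat; nia.
have n2 : (n%:R ^+ 2 <= 4 * q%:R ^+ 2 * (k%:R * k%:R) :> R)%R.
  have -> : (4 * q%:R ^+ 2 * (k%:R * k%:R) = (2 * q%:R * k%:R) ^+ 2 :> R)%R by ring.
  by rewrite lerXn2r // nnegrE // !mulr_ge0.
have cn1 : (75 <= c * n%:R ^+ 2)%R.
  rewrite -ler_pdivrMl // mulrC; apply: (@le_trans _ _ n%:R%R).
    by rewrite (le_trans (ltW (truncnS_gt _))) // ler_nat.
  by rewrite -natrX ler_nat; nia.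
have cn2 : (2 * (c * n%:R ^+ 2) <= rate * (k%:R * k%:R / 100))%R.
  rewrite /c; apply: (@le_trans _ _
      (2 * (rate / (800 * q%:R ^+ 2) * (4 * q%:R ^+ 2 * (k%:R * k%:R))))%R).
    by rewrite ler_pM2l // ler_pM2l.
  rewrite le_eqVlt; apply/orP; left; apply/eqP; field.
  by rewrite gt_eqF.
rewrite natrX; move: cost cn1 cn2; lra.
Qed.
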